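(* Let $F$ be a commutative field, $n\ge 1$, and let $\nu$ be a quadratic embedding of $\mathrm{PG}(n,F)=(\mathcal P,\mathcal L)$ into $\mathrm{PG}(n',F')=(\mathcal P',\mathcal L')$. If $\mathcal M\subset\mathcal P$, then $\dim(\overline{\mathcal M^{\nu}})$ is equal to the largest $i\in\mathbb N$ such that there exists a chain $$\emptyset\subset\mathcal K_0\subset\mathcal K_1\subset\cdots\subset\mathcal K_i=\overline{\overline{\mathcal M}},$$ consisting of $i+2$ distinct closed subsets of $\overline{\overline{\mathcal M}}$. Consequently, $\dim(\overline{\mathcal M^{\nu}})=\dim(\overline{\mathcal M^{\rho}})$, where $\rho$ denotes the quadratic Veronese embedding.
   Context: $F$ is a commutative field; $F'$ is a field, not assumed to be commutative. $\mathrm{PG}(n,F)=(\mathcal P,\mathcal L)$ and $\mathrm{PG}(n',F')=(\mathcal P',\mathcal L')$ are the projective spaces of projective dimension $n$ over $F$ and $n'$ over $F'$, with point sets $\mathcal P,\mathcal P'$ and line sets $\mathcal L,\mathcal L'$. $\mathbb N$ is the set of natural numbers, including $0$. The symbol $\subset$ allows equality; $\dim$ is projective dimension. A quadric of $\mathrm{PG}(n,F)$ is the set of zeros in $\mathcal P$ of a non-zero quadratic form on $F^{n+1}$ (in particular every hyperplane, as a repeated hyperplane, is a quadric). Let $\Phi=\{\mathcal S\subset\mathcal P \mid \mathcal S \text{ is a quadric of } \mathrm{PG}(n,F)\}\cup\{\mathcal P\}$. For $\mathcal M\subset\mathcal P$ the quadratic closure is $\overline{\overline{\mathcal M}}=\bigcap_{\mathcal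 M\subset\mathcal S,\ \mathcal S\in\Phi}\mathcal S$; $\mathcal M$ is a closed set if $\mathcal M=\overline{\overline{\mathcal M}}$. For a set $\mathcal X$ of points of a projective space, $\overline{\mathcal X}$ denotes its linear closure (the smallest subspace containing it). Maps are written as right exponents: $\mathcal M^\nu$ is the image of $\mathcal M$ and $(\cdot)^{\nu^{-1}}$ is the preimage. A map $\nu:\mathcal P\to\mathcal P'$ is a quadratic embedding of $\mathrm{PG}(n,F)$ into $\mathrm{PG}(n',F')$ if $\overline{\overline{\mathcal M}}=(\overline{\mathcal M^\nu})^{\nu^{-1}}$ for all $\mathcal M\subset\mathcal P$, and $\overline{\operatorname{im}\nu}=\mathcal P'$. The quadratic Veronese embedding $\rho$ maps the points of $\mathrm{PG}(n,F)$ to points of $\mathrm{PG}\left(\binom{n+2}{2}-1,F\right)$ by $F(x_0,\ldots,x_n)\mapsto F(y_{ij})_{0\le i\le j\le n}$ with $y_{ij}=x_ix_j$. *)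

(* Defs.v *)
From HB Require Import structures.
From mathcomp Require Import all_boot all_order all_algebra.
From mathcomp Require Import boolp classical_sets.

Set Implicit Arguments.
Unset Strict Implicit.
Unset Printing Implicit Defensive.
Import Order.TTheory GRing.Theory Num.Theory.
Local Open Scope classical_set_scope.
Local Open Scope ring_scope.

(* MathComp has no structure of not necessarily commutative fields: they are
   rendered as a unitRingType satisfying GRing.field_axiom.  Row vectors form a
   left module over the ring of scalars. *)

Section ProjectiveSpace.
Variables (n : nat) (D : unitRingType).

Definition vline (v : 'rV[D]_n.+1) : set 'rV[D]_n.+1 :=
  [set a *: v | a in [set: D]].

(* A point of PG(n, D), as the set of vectors of a subspace D v with v != 0. *)
Record PG := MkPG {
  vects : set 'rV[D]_n.+1;
  vectsP : exists2 v, v != 0 & vects = vline v }.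

Lemma vects_inj : injective vects.
Proof.
case=> A PA [B PB] /= eAB; case: _ / eAB in PB *.
by congr MkPG; exact: Prop_irrelevance.
Qed.

Definition mkPG (v : 'rV[D]_n.+1) (v0 : v != 0) : PG :=
  @MkPG (vline v) (ex_intro2 _ _ v v0 erefl).

(* For p <> q, the points of the line joining p and q. *)
Definition join (p q : PG) : set PG :=
  [set r | vects r `<=` [set u + v | u in vects p & v in vects q]].

Definition lines : set (set PG) :=
  [set l | exists p q, p <> q /\ l = join p q].

Definition subspace (S : set PG) : Prop :=
  forall l, lines l ->
  forall p q, p <> q -> l p -> l q -> S p -> S q -> l `<=` S.

Definition lclosure (X : set PG) : set PG := smallest subspace X.

Definition carrier (S : set PG) : set 'rV[D]_n.+1 :=
  [set v | v = 0 \/ exists2 p, S p & vects p v].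

(* The rows of B form a basis of W (as a left D-space). *)
Definition row_basis k (W : set 'rV[D]_n.+1) (B : 'M[D]_(k, n.+1)) : Prop :=
  injective (fun c : 'rV[D]_k => c *m B) /\
  [set c *m B | c in [set: 'rV[D]_k]] = W.

(* Projective dimension of a subspace: vector space dimension minus one, so
   that the empty subspace has dimension -1. *)
Definition pdim (S : set PG) : int :=
  (get [set k : nat | exists B : 'M[D]_(k, n.+1), row_basis (carrier S) B])%:Z
  - 1.

End ProjectiveSpace.

Section Quadrics.
Variables (n : nat) (F : fieldType).

Definition polar (Q : 'rV[F]_n.+1 -> F) (x y : 'rV[F]_n.+1) : F :=
  Q (x + y) - Q x - Q y.

(* As polar Q is symmetric, linearity in one argument gives bilinearity. *)
Definition quadratic_form (Q : 'rV[F]_n.+1 -> F) : Prop :=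
  (forall a x, Q (a *: x) = a ^+ 2 * Q x) /\
  (forall y, scalar (fun x => polar Q x y)).

Definition zeros (Q : 'rV[F]_n.+1 -> F) : set (PG n F) :=
  [set p | forall x, vects p x -> Q x = 0].

(* A quadratic form sum_(i <= j) a_ij x_i x_j with some nonzero coefficient
   takes a nonzero value at some e_i or e_i + e_j, over every field; so there is
   no difference between non-zero forms and non-zero functions. *)
Definition quadric (S : set (PG n F)) : Prop :=
  exists Q, [/\ quadratic_form Q, exists x, Q x != 0 & S = zeros Q].

Definition Phi : set (set (PG n F)) := [set S | quadric S] `|` [set setT].

Definition qclosure (M : set (PG n F)) : set (PG n F) :=
  \bigcap_(S in [set S | Phi S /\ M `<=` S]) S.

Definition qclosed (M : set (PG n F)) : Prop := M = qclosure M.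

(* The i.+2 members of the chain are set0, K 0, ..., K i. *)
Definition closed_chain (M : set (PG n F)) (i : nat)
    (K : 'I_i.+1 -> set (PG n F)) : Prop :=
  [/\ qclosed set0 /\ (forall j, qclosed (K j)),
      forall j k : 'I_i.+1, (j <= k)%N -> K j `<=` K k,
      (forall j, K j <> set0) /\ injective K
    & K ord_max = qclosure M].

Definition largest_chain (M : set (PG n F)) (i : nat) : Prop :=
  (exists K : 'I_i.+1 -> set (PG n F), closed_chain M K) /\
  (forall j (K : 'I_j.+1 -> set (PG n F)), closed_chain M K -> (j <= i)%N).

Definition quadratic_embedding (n' : nat) (D : unitRingType)
    (nu : PG n F -> PG n' D) : Prop :=
  (forall M : set (PG n F), qclosure M = nu @^-1` lclosure (nu @` M)) /\
  lclosure (range nu) = setT.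

End Quadrics.

Section Veronese.
Variables (n : nat) (F : fieldType).

Definition upair := {ij : 'I_n.+1 * 'I_n.+1 | (ij.1 <= ij.2)%N}.

Lemma card_upair : 'C(n.+2, 2).-1.+1 = #|{: upair}|.
Proof.
rewrite prednK ?bin_gt0 // card_sig -sum1_card.
rewrite (eq_bigl (fun ij : 'I_n.+1 * 'I_n.+1 => true && (ij.1 <= ij.2)%N)) //.
rewrite -(pair_big_dep xpredT (fun i j : 'I_n.+1 => (i <= j)%N)
            (fun _ _ => 1%N)) /= (exchange_big_dep xpredT) //=.
rewrite -bin2_sum big_mkord big_ord_recl add0n; apply: eq_bigr => j _.
rewrite sum1_card -[X in X = _]/(j.+1) -[X in X = _]card_ord.
have w : (j.+1 <= n.+1)%N by [].
rewrite -(card_image (f := widen_ord w)) => [|a b /(congr1 val) /= /val_inj //].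
apply: eq_card => i; apply/fintype.imageP/idP => [[k _ ->]|ij].
  by rewrite unfold_in; exact: (ltn_ord k).
by exists (Ordinal (ij : (i < j.+1)%N)) => //; apply: val_inj.
Qed.

(* An enumeration of the pairs (i, j) with i <= j. *)
Definition upair_of (k : 'I_('C(n.+2, 2).-1.+1)) : upair :=
  enum_val (cast_ord card_upair k).

Definition veronese_vec (x : 'rV[F]_n.+1) : 'rV[F]_('C(n.+2, 2).-1.+1) :=
  \row_k (x 0 (val (upair_of k)).1 * x 0 (val (upair_of k)).2).

Lemma veronese_vec_neq0 x : x != 0 -> veronese_vec x != 0.
Proof.
apply: contra => /eqP /rowP v0; apply/eqP/rowP => i; rewrite mxE.
have := v0 (cast_ord (esym card_upair)
  (enum_rank (Sub (i, i) (leqnn i) : upair))).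
rewrite !mxE /upair_of cast_ordKV enum_rankK /= => /eqP.
by rewrite mulf_eq0 orbb => /eqP.
Qed.

Lemma veronese_vline v :
  [set a *: veronese_vec x | a in [set: F] & x in vline v] =
  vline (veronese_vec v).
Proof.
apply/seteqP; split=> [_ [a _ [_ [b _ <-] <-]]|_ [a _ <-]].
  exists (a * b ^+ 2) => //; rewrite -scalerA; congr (_ *: _).
  by apply/rowP => k; rewrite !mxE expr2 mulrACA.
by exists a => //; exists v => //; exists 1; rewrite ?scale1r.
Qed.

Lemma veronese_subproof (p : PG n F) : exists2 v, v != 0 &
  [set a *: veronese_vec x | a in [set: F] & x in vects p] = vline v.
Proof.
have [v v0 ->] := vectsP p; exists (veronese_vec v); last exact: veronese_vline.
exact: veronese_vec_neq0.
Qed.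

Definition veronese (p : PG n F) : PG 'C(n.+2, 2).-1 F :=
  MkPG (veronese_subproof p).

Lemma veroneseE (x : 'rV[F]_n.+1) (x0 : x != 0) :
  veronese (mkPG x0) = mkPG (veronese_vec_neq0 x0).
Proof.
apply: vects_inj; exact: veronese_vline.
Qed.

End Veronese.

(* Main.v *)
Require Import Defs.
From mathcomp Require Import all_boot all_order all_algebra.
From mathcomp Require Import boolp classical_sets.
From mathcomp Require Import ring.
Local Open Scope classical_set_scope.
Local Open Scope ring_scope.
Import GRing.Theory.

(** A quadratic embedding pulls linear closure back to quadratic closure. A
    strictly increasing chain of closed sets therefore yields linearly
    independent vectors in the span of the image (pick a point in each step), and
    a basis of the span of [M^nu] chosen among the vectors of [M^nu] yields a
    strictly increasing chain of closed sets. So the dimension is the length of a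
    longest chain, a quantity depending only on [M]. The Veronese map satisfies
    the same closure identity because quadratic forms are exactly the linear
    forms in the monomials [x_i x_j] and subspaces are intersections of
    hyperplanes. *)

Set Implicit Arguments.
Unset Strict Implicit.

(** * Linear algebra over a division ring *)

Section DivisionRing.
Variables (D : unitRingType) (DF : GRing.field_axiom D).

Lemma division_mulVr (a : D) : a != 0 -> a^-1 * a = 1.
Proof. by move=> a0; rewrite mulVr // DF. Qed.

Definition submodule m (W : set 'rV[D]_m) : Prop :=
  [/\ W 0, forall u v, W u -> W v -> W (u + v) & forall a u, W u -> W (a *: u)].

Definition row_free_div k m (B : 'M[D]_(k, m)) : Prop :=
  injective (fun c : 'rV[D]_k => c *m B).

Definition row_span k m (B : 'M[D]_(k, m)) : set 'rV[D]_m :=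
  [set c *m B | c in [set: 'rV[D]_k]].

Lemma row_freeP k m (B : 'M[D]_(k, m)) :
  row_free_div B <-> forall c : 'rV[D]_k, c *m B = 0 -> c = 0.
Proof.
split=> [inj c c0|ker c d /= cd]; first by apply: inj; rewrite c0 mul0mx.
by apply/eqP; rewrite -subr_eq0; apply/eqP/ker; rewrite mulmxBl cd subrr.
Qed.

Lemma submodule_sum m (W : set 'rV[D]_m) (I : Type) (r : seq I) (P : pred I)
    (f : I -> 'rV[D]_m) :
  submodule W -> (forall i, P i -> W (f i)) -> W (\sum_(i <- r | P i) f i).
Proof. by case=> W0 WD _ Wf; elim/big_ind: _. Qed.

Lemma submodule_mulmx k m (W : set 'rV[D]_m) (B : 'M[D]_(k, m))
    (c : 'rV[D]_k) :
  submodule W -> (forall i, c 0 i != 0 -> W (row i B)) -> W (c *m B).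
Proof.
move=> sW Wr; rewrite mulmx_sum_row; apply: submodule_sum => // i _.
case: sW => W0 _ WZ; have [->|/Wr] := eqVneq (c 0 i) 0; last exact: WZ.
by rewrite scale0r.
Qed.

Lemma submodule_row_span k m (B : 'M[D]_(k, m)) : submodule (row_span B).
Proof.
split=> [|_ _ [c _ <-] [d _ <-]|a _ [c _ <-]].
- by exists 0; rewrite ?mul0mx.
- by exists (c + d); rewrite ?mulmxDl.
- by exists (a *: c); rewrite ?scalemxAl.
Qed.

Lemma row_in_span k m (B : 'M[D]_(k, m)) i : row_span B (row i B).
Proof. by exists (delta_mx 0 i) => //; rewrite rowE. Qed.

(** Gaussian elimination by induction on the number of columns. A zero first column is dropped;
    otherwise a pivot row clears the first column of the other rows and is removed, so one row and
    one column disappear together. *)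
Lemma wide_kernel m : forall k (A : 'M[D]_(k, m)), (m < k)%N ->
  exists2 c : 'rV[D]_k, c != 0 & c *m A = 0.
Proof.
elim: m => [|m IH] [//|k] A ltmk.
  exists (const_mx 1); last by apply/rowP => -[].
  by apply/eqP => /rowP /(_ ord0); rewrite !mxE; apply/eqP; rewrite oner_neq0.
have tail_zero j (B : 'M[D]_(j, m.+1)) :
    (forall i, B i 0 = 0) -> forall c : 'rV[D]_j,
    c *m (\matrix_(i, l) B i (lift 0 l)) = 0 -> c *m B = 0.
  move=> B0 c c0; apply/rowP => l; case: (unliftP 0 l) => [l' ->|->].
    move/rowP/(_ l'): c0; rewrite !mxE => c0; rewrite -[RHS]c0.
    by apply: eq_bigr => i _; rewrite mxE.
  by rewrite !mxE big1 // => i _; rewrite B0 mulr0.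
have [A0|] := pselect (forall i, A i 0 = 0).
  have [c c0 cA] := IH _ (\matrix_(i, l) A i (lift 0 l)) (ltnW ltmk).
  by exists c => //; apply: tail_zero.
move=> /existsNP[i /eqP Ai0].
(* Row [j] of [E *m A] is row [lift i j] of [A] minus the left multiple of the pivot row [i] that
   makes its first entry vanish. *)
pose E : 'M[D]_(k, k.+1) := \matrix_(j, l)
  ((l == lift i j)%:R - (l == i)%:R * (A (lift i j) 0 / A i 0)).
have sumE (j : 'I_k) (l : 'I_m.+1) :
    (E *m A) j l = A (lift i j) l - A (lift i j) 0 / A i 0 * A i l.
  rewrite mxE (eq_bigr (fun x => (x == lift i j)%:R * A x l -
     (x == i)%:R * (A (lift i j) 0 / A i 0 * A x l))); last first.
    by move=> x _; rewrite mxE mulrBl -!mulrA.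
  rewrite sumrB (bigD1 (lift i j)) //= eqxx mul1r big1 ?addr0; last first.
    by move=> x /negPf ->; rewrite mul0r.
  by rewrite (bigD1 i) //= eqxx mul1r big1 ?addr0 // => x /negPf ->; rewrite mul0r.
have [|c c0 cA] := IH _ (\matrix_(j, l) (E *m A) j (lift 0 l)); first by [].
exists (c *m E); last first.
  rewrite -mulmxA; apply: tail_zero => // j.
  by rewrite sumE -mulrA division_mulVr // mulr1 subrr.
(* The coordinate of [c *m E] at [lift i j] is [c 0 j], so passing from [c] to [c *m E] loses
   nothing. *)
apply: contra_neq c0 => /rowP cE0; apply/rowP => j.
have := cE0 (lift i j); rewrite !mxE => <-.
rewrite (bigD1 j) //= !mxE eqxx eq_sym (negPf (neq_lift _ _)) mul0r subr0 mulr1.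
rewrite big1 ?addr0 // => l /negPf lj; rewrite !mxE (inj_eq lift_inj).
by rewrite [j == l]eq_sym lj eq_sym (negPf (neq_lift _ _)) mul0r subr0 mulr0.
Qed.

(** Steinitz bound: write [C] as [X *m B]. If [X] had more rows than columns, a nonzero vector
    killing [X] would also kill [C]. *)
Lemma row_free_le k l m (B : 'M[D]_(k, m)) (C : 'M[D]_(l, m)) :
  row_free_div C -> (forall i, row_span B (row i C)) -> (l <= k)%N.
Proof.
move=> /row_freeP fC sC; rewrite leqNgt; apply/negP => ltkl.
pose X : 'M[D]_(l, k) := \matrix_i (projT1 (cid2 (sC i))).
have XB : X *m B = C.
  by apply/row_matrixP => i; rewrite row_mul rowK; case: (cid2 _).
have [c c0 cX] := wide_kernel X ltkl.
by case/eqP: c0; apply: fC; rewrite -XB mulmxA cX mul0mx.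
Qed.

Lemma row_free_width k m (B : 'M[D]_(k, m)) : row_free_div B -> (k <= m)%N.
Proof.
move=> fB; apply: (row_free_le (B := 1%:M) fB) => i.
by exists (row i B) => //; rewrite mulmx1.
Qed.

(** A relation with nonzero coefficient at [v] can be solved for [v]; otherwise it is a relation
    among the rows of [B] alone. *)
Lemma row_free_col_mx k m (B : 'M[D]_(k, m)) (v : 'rV[D]_m) :
  row_free_div B -> ~ row_span B v -> row_free_div (col_mx B v).
Proof.
move=> /row_freeP fB vB; apply/row_freeP => c.
rewrite -[c]hsubmxK mul_row_col [rsubmx c]mx11_scalar mul_scalar_mx.
set a := _ 0 0 => cv.
have a0 : a = 0.
  have [//|a0] := eqVneq a 0; case: vB.
  exists (- (a^-1 *: lsubmx c)) => //; rewrite mulNmx -scalemxAl.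
  move/eqP: cv; rewrite addr_eq0 => /eqP ->.
  by rewrite scalerN opprK scalerA division_mulVr // scale1r.
by move: cv; rewrite a0 scale0r addr0 => /fB ->; rewrite raddf0 row_mx0.
Qed.

(** Take an independent family in [G] of maximal length, which exists because lengths are bounded by
    [m]. A member of [G] outside its span could be appended. *)
Lemma basis_from_generators m (G : set 'rV[D]_m) :
  exists k (B : 'M[D]_(k, m)),
    [/\ row_free_div B, forall i, G (row i B) & G `<=` row_span B].
Proof.
pose P k := `[< exists B : 'M[D]_(k, m),
   row_free_div B /\ forall i, G (row i B) >].
have P0 : exists k, P k.
  exists 0%N; apply/asboolP; exists 0; split; last by case.
  by move=> c d _; apply/rowP => -[].
have Pm k : P k -> (k <= m)%N.
  by move/asboolP => [B [fB _]]; exact: row_free_width fB.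
case: (ex_maxnP P0 Pm) => k /asboolP[B [fB GB]] kmax.
exists k, B; split=> // v Gv; apply: contrapT => vB.
have /kmax : P (k + 1)%N; last by rewrite addn1 ltnn.
apply/asboolP; exists (col_mx B v); split; first exact: row_free_col_mx.
move=> i; case: (split_ordP i) => j ->; first by rewrite rowKu.
by rewrite rowKd row_id.
Qed.

(** In a nontrivial relation let [j] be the last index with nonzero coefficient. Solving for row [j]
    expresses it by earlier rows, all of which lie in [W j]. *)
Lemma row_free_flag k m (B : 'M[D]_(k, m)) (W : 'I_k -> set 'rV[D]_m) :
  (forall j, submodule (W j)) ->
  (forall i j : 'I_k, (i < j)%N -> W j (row i B)) ->
  (forall j, ~ W j (row j B)) -> row_free_div B.
Proof.
move=> sW WB nWB; apply/row_freeP => c cB.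
apply: contrapT => /eqP c0.
have [i0 ci0] : exists i, c 0 i != 0.
  apply: contrapT => nex; case/eqP: c0; apply/rowP => i; rewrite mxE.
  by apply/eqP; apply: contrapT => /negP ci; apply: nex; exists i.
case: (@arg_maxnP _ i0 (fun i => c 0 i != 0) (fun i => i : nat) ci0)
  => j cj jmax.
apply: (nWB j); move: cB; rewrite mulmx_sum_row (bigD1 j) //=.
move/eqP; rewrite addr_eq0 => /eqP cjE.
have -> : row j B = (c 0 j)^-1 *: - \sum_(i | i != j) c 0 i *: row i B.
  by rewrite -cjE scalerA division_mulVr // scale1r.
case: (sW j) => W0 _ WZ; apply: (WZ); rewrite -scaleN1r; apply: (WZ).
apply: submodule_sum => // i ij; have [->|ci] := eqVneq (c 0 i) 0.
  by rewrite scale0r.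
by apply: (WZ); apply: WB; rewrite ltn_neqAle ij; exact: jmax.
Qed.

(** This is the span of the rows of [B] that precede row [j]; it serves to show that an independent
    row [j] escapes that span. *)
Lemma submodule_initial_coords k m (B : 'M[D]_(k, m)) (j : 'I_k) :
  submodule [set c *m B |
    c in [set c : 'rV[D]_k | forall i : 'I_k, (j <= i)%N -> c 0 i = 0]].
Proof.
split=> [|_ _ [c /= c0 <-] [d /= d0 <-]|a _ [c /= c0 <-]].
- by exists 0; rewrite ?mul0mx // => i; rewrite mxE.
- by exists (c + d); rewrite ?mulmxDl // => i ji; rewrite mxE c0 ?d0 ?addr0.
- by exists (a *: c); rewrite ?scalemxAl // => i ji; rewrite mxE c0 ?mulr0.
Qed.

(** * Subspaces of the projective space and submodules *)

Variable n : nat.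
Implicit Types (p q : PG n D) (X S : set (PG n D)) (W : set 'rV[D]_n.+1).

Lemma vects0 p : vects p 0.
Proof. by have [v _ ->] := vectsP p; exists 0; rewrite ?scale0r. Qed.

Lemma vectsZ p a v : vects p v -> vects p (a *: v).
Proof.
have [w _ ->] := vectsP p => -[b _ <-]; exists (a * b) => //.
by rewrite scalerA.
Qed.

Lemma vectsD p u v : vects p u -> vects p v -> vects p (u + v).
Proof.
have [w _ ->] := vectsP p => -[b _ <-] [c _ <-]; exists (b + c) => //.
by rewrite scalerDl.
Qed.

Lemma vects_eq p v : vects p v -> v != 0 -> vects p = Defs.vline v.
Proof.
have [w _ ->] := vectsP p => -[b _ <-] bw0.
have b0 : b != 0 by apply: contra_neq bw0 => ->; rewrite scale0r.
apply/seteqP; split=> _ [a _ <-].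
  by exists (a * b^-1) => //; rewrite scalerA -mulrA division_mulVr // mulr1.
by exists (a * b) => //; rewrite scalerA.
Qed.

Lemma PG_eq p q v : vects p v -> vects q v -> v != 0 -> p = q.
Proof.
by move=> pv qv v0; apply: vects_inj; rewrite (vects_eq pv v0) (vects_eq qv v0).
Qed.

Lemma PG_vect p : exists2 v, v != 0 & vects p v.
Proof.
by have [v v0 ->] := vectsP p; exists v => //; exists 1; rewrite ?scale1r.
Qed.

Lemma vects_sub W p v : submodule W -> vects p v -> v != 0 -> W v ->
  vects p `<=` W.
Proof.
by case=> _ _ WZ pv v0 Wv; rewrite (vects_eq pv v0) => _ [a _ <-]; exact: WZ.
Qed.

Lemma joinl p q : join p q p.
Proof.
by move=> v pv; exists v => //; exists 0; rewrite ?addr0 //; exact: vects0.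
Qed.

Lemma joinr p q : join p q q.
Proof.
by move=> v qv; exists 0; [exact: vects0|exists v; rewrite ?add0r].
Qed.

(** For vectors [u], [v] of distinct points of [S], a nonzero [u + v] spans a point of the line
    joining them, and this line lies in [S]. *)
Lemma submodule_carrier S : subspace S -> submodule (carrier S).
Proof.
move=> sS; split=> [|u v|a u]; first by left.
  case=> [->|[p Sp pu]]; first by rewrite add0r.
  case=> [->|[q Sq qv]]; first by rewrite addr0; right; exists p.
  have [->|/eqP uv0] := eqVneq (u + v) 0; first by left.
  right; have [pq|pq] := pselect (p = q).
    by exists p => //; apply: vectsD => //; rewrite pq.
  move/eqP: uv0 => uv0.
  exists (mkPG uv0); last by exists 1; rewrite ?scale1r.
  have jl : lines (join p q) by exists p, q.
  apply: (sS _ jl p q) => //; [exact: joinl|exact: joinr|].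
  move=> _ [a _ <-]; exists (a *: u); first exact: vectsZ.
  by exists (a *: v); rewrite ?scalerDr //; exact: vectsZ.
case=> [->|[p Sp pu]]; first by left; rewrite scaler0.
by right; exists p => //; exact: vectsZ.
Qed.

Lemma subspace_of_submodule W : submodule W ->
  subspace [set p | vects p `<=` W].
Proof.
move=> sW l [p0 [q0 [pq0 ->]]] p q pq lp lq /= Wp Wq r lr.
(* If [r] were not in the span [C] of [p] and [q], the line, which is spanned by
   the two rows of [B], would contain three independent vectors. *)
have [u u0 pu0] := PG_vect p0; have [w w0 qw0] := PG_vect q0.
have [u1 u10 pu1] := PG_vect p; have [w1 w10 qw1] := PG_vect q.
pose B : 'M[D]_(1 + 1, n.+1) := col_mx u w.
pose C : 'M[D]_(1 + 1, n.+1) := col_mx u1 w1.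
have jB s x : join p0 q0 s -> vects s x -> row_span B x.
  move=> js /js [y]; rewrite (vects_eq pu0 u0) => -[a _ <-] [z].
  rewrite (vects_eq qw0 w0) => -[b _ <-] <-.
  exists (row_mx a%:M b%:M) => //.
  by rewrite mul_row_col !mul_scalar_mx.
have fC : row_free_div C.
  apply: row_free_col_mx.
    apply/row_freeP => c; rewrite [c]mx11_scalar mul_scalar_mx.
    have [-> //|c0] := eqVneq (c 0 0) 0; first by rewrite raddf0.
    move/(congr1 (fun x => (c 0 0)^-1 *: x)).
    rewrite scalerA division_mulVr // scale1r scaler0.
    by move/eqP; rewrite (negPf u10).
  move=> [c _ cw]; apply: pq; apply: (PG_eq _ qw1 w10).
  by rewrite -cw [c]mx11_scalar mul_scalar_mx; exact: vectsZ.
move=> x rx; apply: contrapT => Wx.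
have : row_free_div (col_mx C x).
  apply: row_free_col_mx => // -[c _ cx]; apply: Wx; rewrite -cx.
  apply: submodule_mulmx => // i _.
  case: (split_ordP i) => j ->.
    by rewrite rowKu row_id; exact: Wp.
  by rewrite rowKd row_id; exact: Wq.
move/(row_free_le (B := B)) => le32.
suff : (1 + 1 + 1 <= 1 + 1)%N by [].
apply: le32 => i; case: (split_ordP i) => j ->; last first.
  by rewrite rowKd row_id; exact: jB rx.
rewrite rowKu; case: (split_ordP j) => k ->.
  by rewrite rowKu row_id; exact: jB pu1.
by rewrite rowKd row_id; exact: jB qw1.
Qed.

Lemma subset_lclosure X : X `<=` lclosure X.
Proof. by move=> p Xp S [_]; apply. Qed.

Lemma subspace_lclosure X : subspace (lclosure X).
Proof.
move=> l ll p q pq lp lq Xp Xq r lr S [sS XS].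
by apply: (sS l ll p q) => //; [apply: Xp|apply: Xq].
Qed.

Lemma lclosure_sub X S : subspace S -> X `<=` S -> lclosure X `<=` S.
Proof. by move=> sS XS p; apply. Qed.

Lemma lclosure_vects X W p : submodule W -> (forall q, X q -> vects q `<=` W) ->
  lclosure X p -> vects p `<=` W.
Proof.
by move=> /subspace_of_submodule sW XW; apply: (lclosure_sub sW XW).
Qed.

Lemma carrier_vects S p v : vects p v -> v != 0 -> carrier S v -> S p.
Proof.
move=> pv v0 [v0'|[q Sq qv]]; first by rewrite v0' eqxx in v0.
by rewrite (PG_eq pv qv v0).
Qed.

Lemma carrier_lclosure_sub X W : submodule W ->
  (forall q, X q -> vects q `<=` W) -> carrier (lclosure X) `<=` W.
Proof.
move=> sW XW v [->|[p Xp pv]]; first by case: sW.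
exact: (lclosure_vects sW XW Xp).
Qed.

Lemma lclosure0 : lclosure (set0 : set (PG n D)) = set0.
Proof. by apply/seteqP; split=> // p /(_ set0); apply; split. Qed.

(** The vectors of the points of [X] generate the carrier of the closure, so a basis can be selected
    among them. That the rows come from [X] itself is what the construction of chains uses. *)
Lemma lclosure_basis X : exists k (B : 'M[D]_(k, n.+1)),
  row_basis (carrier (lclosure X)) B /\
  forall i, exists2 p, X p & vects p (row i B).
Proof.
have [k [B [fB GB sB]]] :=
  basis_from_generators [set v | exists2 p, X p & vects p v].
exists k, B; split=> //; split=> //; apply/seteqP; split; last first.
  apply: carrier_lclosure_sub; first exact: submodule_row_span.
  by move=> q Xq v qv; apply: sB; exists q.
move=> _ [c _ <-]; apply: submodule_mulmx => [|i _].
  by apply: submodule_carrier => //; exact: subspace_lclosure.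
by have [p Xp pB] := GB i; right; exists p => //; exact: subset_lclosure.
Qed.

(** [pdim] picks the length of some basis; it is well defined because each of two bases lies in the
    span of the other. *)
Lemma pdim_basis S k (B : 'M[D]_(k, n.+1)) :
  row_basis (carrier S) B -> pdim S = k%:Z - 1.
Proof.
move=> [fB sB]; rewrite /pdim; case: xgetP => [l _ [C [fC sC]]|/(_ k)[]];
  last by exists B.
have eqs : row_span B = row_span C by rewrite /row_span sB sC.
congr (Posz _ - 1); apply/eqP; rewrite eqn_leq; apply/andP; split.
  by apply: (row_free_le (B := B) fC) => i; rewrite eqs; exact: row_in_span.
by apply: (row_free_le (B := C) fB) => i; rewrite -eqs; exact: row_in_span.
Qed.

End DivisionRing.

(** * Chains of closed sets and the dimension of spans of images *)

Section Chains.
Variables (F : fieldType) (n : nat).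

Lemma subset_qclosure (M : set (PG n F)) : M `<=` qclosure M.
Proof. by move=> p Mp S [_]; apply. Qed.

Lemma qclosureS (M N : set (PG n F)) : M `<=` N -> qclosure M `<=` qclosure N.
Proof. by move=> MN p Mp S [PS NS]; apply: Mp; split=> // q /MN /NS. Qed.

Lemma qclosure_idem (M : set (PG n F)) : qclosed (qclosure M).
Proof.
apply/seteqP; split; first exact: subset_qclosure.
by move=> p Mp S [PS MS]; apply: Mp; split=> // q; apply.
Qed.

Lemma largest_chain_uniq (M : set (PG n F)) i j :
  largest_chain M i -> largest_chain M j -> i = j.
Proof.
move=> [[K cK] iM] [[L cL] jM]; apply/eqP.
by rewrite eqn_leq (jM _ K cK) (iM _ L cL).
Qed.

Variables (n' : nat) (D : unitRingType) (DF : GRing.field_axiom D).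
Variable nu : PG n F -> PG n' D.
(** The closure identity is isolated so that the section applies both to the given embedding and to
    [veronese]. *)
Hypothesis nuE :
  forall M : set (PG n F), qclosure M = nu @^-1` lclosure (nu @` M).

Lemma qclosure0 : qclosure (set0 : set (PG n F)) = set0.
Proof. by rewrite nuE image_set0 lclosure0. Qed.

(** By [nuE] the image of the closure already lies in the span of the image of [M]. Hence points
    taken from a chain ending in [qclosure M] have their images in that span. *)
Lemma lclosure_qclosure M : lclosure (nu @` qclosure M) = lclosure (nu @` M).
Proof.
apply/seteqP; split; apply: lclosure_sub; try exact: subspace_lclosure.
  by move=> _ [p Mp <-]; rewrite nuE in Mp.
move=> _ [p Mp <-]; apply: subset_lclosure; exists p => //.
exact: subset_qclosure.
Qed.

(** Each [K j] has a point outside the closure of its predecessors. The images of these [i.+1]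
    points give independent vectors in a span of dimension [k]. *)
Lemma chain_le M k (B : 'M[D]_(k, n'.+1)) i (K : 'I_i.+1 -> set (PG n F)) :
  row_basis (carrier (lclosure (nu @` M))) B -> closed_chain M K -> (i < k)%N.
Proof.
move=> [fB sB] [[q0 qK] mK [K0 injK] Kmax].
(* A union rather than [K] at the preceding index, so that [j = 0] is covered too, with the empty
   union. *)
pose prev (j : 'I_i.+1) : set (PG n F) :=
  \bigcup_(l in [set l : 'I_i.+1 | (l < j)%N]) K l.
have prevP j : exists2 p, K j p & ~ qclosure (prev j) p.
  apply: contrapT => nex.
  have Kj : K j `<=` qclosure (prev j).
    by move=> p Kp; apply: contrapT => np; apply: nex; exists p.
  (* At index 0 the set [K j] would lie in the closure of the empty set, hence be empty; at a later
     index it would equal its predecessor, against injectivity. *)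
  case: j {nex} Kj => -[|j] lej Kj.
    apply: (K0 (Ordinal lej)); apply/seteqP; split=> // p /Kj.
    suff -> : prev (Ordinal lej) = set0 by rewrite qclosure0.
    by apply/seteqP; split=> // q [l].
  pose j' : 'I_i.+1 := Ordinal (ltnW lej).
  suff /injK /(congr1 val) /= /eqP : K (Ordinal lej) = K j'.
    by rewrite eqn_leq ltnn.
  apply/seteqP; split; last by apply: mK => /=.
  apply: (subset_trans Kj); rewrite [X in _ `<=` X](qK j').
  by apply: qclosureS => q [l /= lj]; apply: mK.
pose pt j := projT1 (cid2 (prevP j)).
have ptK j : K j (pt j) by rewrite /pt; case: cid2.
have ptN j : ~ qclosure (prev j) (pt j) by rewrite /pt; case: cid2.
pose w j := projT1 (cid2 (PG_vect (nu (pt j)))).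
have w0 j : w j != 0 by rewrite /w; case: cid2.
have wP j : vects (nu (pt j)) (w j) by rewrite /w; case: cid2.
pose C : 'M[D]_(i.+1, n'.+1) := \matrix_j w j.
apply: (@row_free_le _ DF _ _ _ B C); last first.
  move=> j; rewrite rowK [row_span B]sB; right; exists (nu (pt j)) => //.
  rewrite -lclosure_qclosure; apply: subset_lclosure; exists (pt j) => //.
  by rewrite -Kmax; apply: (mK j) => //; rewrite -ltnS ltn_ord.
(* The flag consists of the spans of the images of the earlier sets; [nuE] turns avoidance of the
   quadratic closure into avoidance of the span. *)
apply: (@row_free_flag _ DF _ _ _ (fun j => carrier (lclosure (nu @` prev j)))).
- by move=> j; apply: submodule_carrier => //; exact: subspace_lclosure.
- move=> l j lj; rewrite rowK; right; exists (nu (pt l)) => //.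
  by apply: subset_lclosure; exists (pt l) => //; exists l.
- move=> j; rewrite rowK => /(carrier_vects DF (wP j) (w0 j)) cj.
  by apply: (ptN j); rewrite nuE.
Qed.

(** Each basis row comes from a point of [M], and the closures of the initial segments of these
    points form the chain. Independence makes it strict, and spanning makes its last member
    [qclosure M]. *)
Lemma chain_exists M k (B : 'M[D]_(k.+1, n'.+1)) :
  row_basis (carrier (lclosure (nu @` M))) B ->
  (forall i, exists2 p, (nu @` M) p & vects p (row i B)) ->
  exists K : 'I_k.+1 -> set (PG n F), closed_chain M K.
Proof.
move=> [fB sB] rB.
have {}rB i : exists2 p, M p & vects (nu p) (row i B).
  by have [_ [p Mp <-] pB] := rB i; exists p.
pose pt i := projT1 (cid2 (rB i)).
have ptM i : M (pt i) by rewrite /pt; case: cid2.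
have ptB i : vects (nu (pt i)) (row i B) by rewrite /pt; case: cid2.
have B0 i : row i B != 0.
  apply/eqP => rB0; have : delta_mx 0 i = 0 :> 'rV[D]_k.+1.
    by apply: fB; rewrite mul0mx -rowE.
  by move/rowP/(_ i); rewrite !mxE !eqxx; apply/eqP; rewrite oner_neq0.
pose G (j : 'I_k.+1) : set (PG n F) := pt @` [set l : 'I_k.+1 | (l <= j)%N].
have GN (i j : 'I_k.+1) : (i < j)%N -> ~ qclosure (G i) (pt j).
  move=> ij; rewrite nuE => Gj.
  (* The points of [G i] have their images in the span of the rows before [j]. Row [j] is not there:
     its only coordinate vector is [delta_mx 0 j], which is 1 at [j]. *)
  have sub := @submodule_initial_coords D _ _ B j.
  have /(_ _ _ (ptB j)) [|c cj] := lclosure_vects DF sub _ Gj.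
    move=> _ [_ [l /= li <-] <-]; apply: (vects_sub DF sub (ptB l) (B0 l)).
    exists (delta_mx 0 l); last by rewrite rowE.
    move=> h jh; rewrite mxE /=; case: eqP => //= hl.
    by move: (leq_trans ij jh); rewrite hl ltnNge li.
  rewrite rowE => /fB cE; move: (cj j (leqnn _)); rewrite cE mxE !eqxx.
  by apply/eqP; rewrite oner_neq0.
have ptG j : qclosure (G j) (pt j).
  by apply: subset_qclosure; exists j => /=.
have inj (i j : 'I_k.+1) : (i < j)%N -> qclosure (G i) <> qclosure (G j).
  by move=> ij eqG; apply: (GN _ _ ij); rewrite eqG.
exists (fun j => qclosure (G j)); split.
- by split=> [|j]; [rewrite /qclosed qclosure0|exact: qclosure_idem].
- move=> i j ij; apply: qclosureS => _ [l /= li <-]; exists l => //=.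
  exact: leq_trans ij.
- split=> [j Gj0|i j eqG]; first by have := ptG j; rewrite Gj0.
  apply/val_inj; case: (ltngtP (val i) (val j)) => // /inj; first by [].
  by move/esym: eqG.
- apply/seteqP; split; first by apply: qclosureS => _ [l _ <-].
  rewrite !nuE => q; apply: lclosure_sub; first exact: subspace_lclosure.
  move=> _ [p Mp <-]; have [v v0 pv] := PG_vect (nu p).
  apply: (carrier_vects DF pv v0).
  have : carrier (lclosure (nu @` M)) v.
    by right; exists (nu p) => //; apply: subset_lclosure; exists p.
  rewrite -sB => -[c _ <-]; apply: submodule_mulmx => [|i _].
    by apply: submodule_carrier => //; exact: subspace_lclosure.
  right; exists (nu (pt i)) => //; apply: subset_lclosure; exists (pt i) => //.
  by exists i => //=; rewrite -ltnS ltn_ord.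
Qed.

Lemma pdim_largest_chain M : M !=set0 ->
  exists2 i : nat, largest_chain M i & pdim (lclosure (nu @` M)) = i%:Z.
Proof.
move=> [p Mp]; have [k [B [bB rB]]] := lclosure_basis DF (nu @` M).
(* An empty basis is excluded, since the image of a point of [M] contributes a nonzero vector. *)
case: k B bB rB => [|k] B bB rB.
  have [v v0 pv] := PG_vect (nu p).
  have : carrier (lclosure (nu @` M)) v.
    by right; exists (nu p) => //; apply: subset_lclosure; exists p.
  case: bB => _ <- [c _ cv]; move: v0; rewrite -cv.
  by rewrite [c](_ : _ = 0) ?mul0mx ?eqxx //; apply/rowP => -[].
exists k; last by rewrite (pdim_basis DF bB) -addn1 PoszD addrK.
split; first exact: chain_exists rB.
by move=> j K cK; rewrite -ltnS; exact: chain_le bB cK.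
Qed.

Lemma pdim_set0 : pdim (lclosure (nu @` set0)) = - 1.
Proof.
have [[|k] [B [bB rB]]] := lclosure_basis DF (nu @` set0).
  by rewrite (pdim_basis DF bB).
by have [_ [p []]] := rB ord0.
Qed.

(** The last member of such a chain would be nonempty and yet equal to the closure of the empty set.
    This matches the dimension -1, which is not a natural number. *)
Lemma no_chain_set0 i :
  ~ exists K : 'I_i.+1 -> set (PG n F), closed_chain set0 K.
Proof.
by move=> [K [_ _ [K0 _] Kmax]]; apply: (K0 ord_max); rewrite Kmax qclosure0.
Qed.

End Chains.

(** * The Veronese map *)

Section VeroneseClosure.
Variables (F : fieldType) (n : nat).

Definition veronese_linear (Q : 'rV[F]_n.+1 -> F) : Prop :=
  exists A : 'cV[F]_('C(n.+2, 2).-1.+1),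
    forall x, Q x = (veronese_vec x *m A) 0 0.

Lemma veronese_vecZ a (x : 'rV[F]_n.+1) :
  veronese_vec (a *: x) = a ^+ 2 *: veronese_vec x.
Proof. by apply/rowP => k; rewrite !mxE; ring. Qed.

Lemma veronese_linear0 : veronese_linear (fun=> 0).
Proof. by exists 0 => x; rewrite mulmx0 mxE. Qed.

Lemma veronese_linearD Q R : veronese_linear Q -> veronese_linear R ->
  veronese_linear (fun x => Q x + R x).
Proof.
by move=> [A QA] [B RB]; exists (A + B) => x; rewrite QA RB mulmxDr [RHS]mxE.
Qed.

Lemma veronese_linear_sum (I : Type) (r : seq I) (Q : I -> 'rV[F]_n.+1 -> F) :
  (forall i, veronese_linear (Q i)) ->
  veronese_linear (fun x => \sum_(i <- r) Q i x).
Proof.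
move=> QL; elim: r => [|i r IH].
  by under eq_fun do rewrite big_nil; exact: veronese_linear0.
by under eq_fun do rewrite big_cons; exact: veronese_linearD.
Qed.

Lemma veronese_linear_monomial a (i j : 'I_n.+1) :
  veronese_linear (fun x => a * (x 0 i * x 0 j)).
Proof.
(* Veronese coordinates are indexed by ordered pairs with [i <= j]; commutativity of [F] allows the
   swap. *)
wlog ij : i j / (i <= j)%N => [H|].
  have [/H //|/ltnW /H [A QA]] := leqP i j.
  by exists A => x; rewrite -QA [x 0 j * _]mulrC.
pose k := cast_ord (esym (card_upair n)) (enum_rank (Sub (i, j) ij : upair n)).
exists (a *: delta_mx k 0) => x.
rewrite -scalemxAr -colE !mxE /upair_of cast_ordKV enum_rankK //=.
Qed.

(** Expanding [Q] over the standard basis gives the squares with coefficients [Q (delta_mx 0 i)] and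
    the mixed products with polar coefficients. No division by 2 occurs, so every characteristic is
    covered. *)
Lemma quadratic_form_veronese (Q : 'rV[F]_n.+1 -> F) :
  quadratic_form Q -> veronese_linear Q.
Proof.
move=> [QZ Qlin].
have polC x y : polar Q x y = polar Q y x.
  by rewrite /polar [x + y]addrC; ring.
have polZ a x y : polar Q (a *: x) y = a * polar Q x y.
  (* Linearity is stated for [a *: x + z]; homogeneity is its case [z = 0], once the polar form is
     known to vanish there. *)
  have p0 z : polar Q 0 z = 0.
    by rewrite /polar add0r -(scale0r z) QZ; ring.
  by have := Qlin y a x 0; rewrite /= p0 !addr0.
have polD x x' y : polar Q (x + x') y = polar Q x y + polar Q x' y.
  by have := Qlin y 1 x x'; rewrite /= scale1r mul1r.
have expand (r : seq 'I_n.+1) :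
    veronese_linear (fun x => Q (\sum_(i <- r) x 0 i *: delta_mx 0 i)).
  elim: r => [|i r IH].
    have Q0 : Q 0 = 0 by rewrite -(scale0r (0 : 'rV[F]_n.+1)) QZ; ring.
    by under eq_fun do rewrite big_nil Q0; exact: veronese_linear0.
  have QE (x : 'rV[F]_n.+1) :
      Q (\sum_(j <- i :: r) x 0 j *: delta_mx 0 j) =
      (Q (delta_mx 0 i) * (x 0 i * x 0 i) +
       Q (\sum_(j <- r) x 0 j *: delta_mx 0 j)) +
      \sum_(j <- r) polar Q (delta_mx 0 i) (delta_mx 0 j) * (x 0 i * x 0 j).
    rewrite big_cons; set y := \sum_(j <- r) _.
    have <- : polar Q (x 0 i *: delta_mx 0 i) y =
        \sum_(j <- r) polar Q (delta_mx 0 i) (delta_mx 0 j) * (x 0 i * x 0 j).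
      rewrite polZ polC /y; elim: r {IH y} => [|j r IH].
        by rewrite !big_nil -(scale0r 0) polZ mul0r mulr0.
      rewrite !big_cons polD polZ mulrDr IH [polar Q (delta_mx 0 j) _]polC.
      by congr (_ + _); ring.
    by rewrite /polar QZ; ring.
  under eq_fun do rewrite QE.
  do 2?apply: veronese_linearD => //; first exact: veronese_linear_monomial.
  by apply: veronese_linear_sum => j; exact: veronese_linear_monomial.
have [A QA] := expand (index_enum _); exists A => x; rewrite -QA.
by rewrite -row_sum_delta.
Qed.

(** Each Veronese coordinate is a product of two coordinates of [x], so its polar form is
    bilinear. *)
Lemma veronese_quadratic_form (A : 'cV[F]_('C(n.+2, 2).-1.+1)) :
  quadratic_form (fun x : 'rV[F]_n.+1 => (veronese_vec x *m A) 0 0).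
Proof.
split=> [a x|y a u v]; first by rewrite veronese_vecZ -scalemxAl mxE.
rewrite /polar !mxE -!sumrB mulr_sumr -big_split /=; apply: eq_bigr => k _.
by rewrite !mxE; ring.
Qed.

(** The columns of [cokermx B] are linear forms whose common zeros are the row space of [B]; one of
    them is nonzero at [v]. *)
Lemma separating_form N (W : set 'rV[F]_N.+1) k (B : 'M[F]_(k, N.+1)) v :
  row_basis W B -> ~ W v ->
  exists A : 'cV[F]_N.+1, (forall u, W u -> (u *m A) 0 0 = 0) /\
    (v *m A) 0 0 != 0.
Proof.
move=> [_ <-] Wv.
have : v *m cokermx B != 0.
  rewrite -submxE; apply/negP => /submxP[c vE]; apply: Wv.
  by exists c; rewrite ?vE.
move=> /eqP vB; have [j vBj] : exists j, (v *m cokermx B) 0 j != 0.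
  apply: contrapT => nex; apply: vB; apply/rowP => j; rewrite [RHS]mxE.
  by apply/eqP; apply: contrapT => /negP vj; apply: nex; exists j.
exists (col j (cokermx B)).
split=> [_ [c _ <-]|]; last by rewrite colE mulmxA -colE mxE.
by rewrite colE mulmxA -(mulmxA c) mulmx_coker mulmx0 mul0mx mxE.
Qed.

Lemma vects_veronese (p : PG n F) x :
  vects p x -> vects (veronese p) (veronese_vec x).
Proof. by move=> px; exists 1 => //; exists x; rewrite ?scale1r. Qed.

Lemma qclosure_veronese (M : set (PG n F)) :
  qclosure M = (@veronese n F) @^-1` lclosure ((@veronese n F) @` M).
Proof.
have FF := @fieldP F.
apply/seteqP; split=> p.
  have [v v0 pv] := PG_vect p => Mp /=.
  apply: (carrier_vects FF (vects_veronese pv) (veronese_vec_neq0 v0)).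
  apply: contrapT => nv.
  have [k [B [bB _]]] := lclosure_basis FF ((@veronese n F) @` M).
  have [A [A0 Av]] := separating_form bB nv.
  (* If the image of [p] were outside the span, the separating hyperplane would pull back to a
     quadric through [M]. The vector [v] of [p] shows both that the form is nonzero and that [p] is
     not on the quadric. *)
  have /(_ v pv) : zeros (fun x => (veronese_vec x *m A) 0 0) p.
    apply: Mp; split.
      left; exists (fun x => (veronese_vec x *m A) 0 0); split=> //.
        exact: veronese_quadratic_form.
      by exists v.
    move=> q Mq x qx; apply: A0; right; exists (veronese q).
      by apply: subset_lclosure; exists q.
    exact: vects_veronese.
  by apply/eqP.
(* Conversely, a quadric through [M] is the preimage of a hyperplane, which contains the span of the
   image of [M]. *)
move=> /= Lp S [[[Q [qQ _ ->]] MQ|->//]].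
have [A QA] := quadratic_form_veronese qQ.
have sA : submodule [set u : 'rV[F]_('C(n.+2, 2).-1.+1) | (u *m A) 0 0 = 0].
  split=> [|u w|a u] /=; first by rewrite mul0mx mxE.
    by move=> uA wA; rewrite mulmxDl [LHS]mxE uA wA addr0.
  by move=> uA; rewrite -scalemxAl [LHS]mxE uA mulr0.
move=> x px; rewrite QA; apply: (lclosure_vects FF sA _ Lp); last first.
  exact: vects_veronese.
move=> _ [q Mq <-] _ [a _ [y qy <-]] /=.
by rewrite -scalemxAl [LHS]mxE -QA (MQ _ Mq) ?mulr0.
Qed.

End VeroneseClosure.

Theorem proposition2p2 (F : fieldType) (n : nat) (n_ge1 : (1 <= n)%N)
    (F' : unitRingType) (F'_field : GRing.field_axiom F') (n' : nat)
    (nu : PG n F -> PG n' F') (nu_qemb : quadratic_embedding nu)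
    (M : set (PG n F)) :
  [/\ M !=set0 ->
        exists2 i : nat, largest_chain M i & pdim (lclosure (nu @` M)) = i%:Z,
      M = set0 ->
        (forall i, ~ exists K : 'I_i.+1 -> set (PG n F), closed_chain M K) /\
        pdim (lclosure (nu @` M)) = - 1
    & pdim (lclosure (nu @` M)) = pdim (lclosure ((@veronese n F) @` M))].
Proof.
have [nuE _] := nu_qemb; have rhoE := @qclosure_veronese F n.
have FF := @fieldP F.
split; first exact: pdim_largest_chain.
  move=> ->; split; [exact: (no_chain_set0 nuE)|exact: pdim_set0].
have [->|/set0P M0] := eqVneq M set0; first by rewrite !pdim_set0.
(* Both dimensions are lengths of a longest chain for the same [M], a notion that does not involve
   the embedding. *)
have [i Mi ->] := pdim_largest_chain F'_field nuE M0.
have [j Mj ->] := pdim_largest_chain FF rhoE M0.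
by rewrite (largest_chain_uniq Mi Mj).
Qed.
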